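(* Let $\alpha,\beta>-1$, let $l,m,n\in\mathbb{N}_0$ with $m\le n$ and $l\in\{n-m,\ldots,n+m\}$, and write $\mathsf{a}_{k,n,m}=\mathsf{a}_{k,n,m}^{\alpha,\beta}$. Then the following three relations hold (for parameter values for which the displayed denominators do not vanish): $$\frac{2(\alpha-\beta)(\alpha+\beta)(m-n)(\alpha+\beta+m+n+1)(\alpha+\beta+2n+1)}{(\alpha+\beta+2m)(\alpha+\beta+2n)}\mathsf{a}_{l+m-n,n,m}$$ $$+\frac{(\alpha+\beta+m+1)(m+1)(\alpha+\beta+2n+1)(\alpha+\beta+2n+2)}{\alpha+\beta+2m+1}\mathsf{a}_{l+m-n+1,n,m+1}$$ $$+\frac{(\alpha+m)(\beta+m)(\alpha+\beta+2m+2)(\alpha+\beta+2n+1)(\alpha+\beta+2n+2)}{(\alpha+\beta+2m)(\alpha+\beta+2m+1)}\mathsf{a}_{l+m-n-1,n,m-1}$$ $$-(\alpha+\beta+2m+2)(\alpha+\beta+n+1)(n+1)\mathsf{a}_{l+m-n-1,n+1,m}-\frac{(\alpha+\beta+2m+2)(\alpha+n)(\beta+n)(\alpha+\beta+2n+2)}{\alpha+\beta+2n}\mathsf{a}_{l+m-n+1,n-1,m}=0;$$ $$\frac{2(\alpha-\beta)(\alpha+\beta)(l-n)(\alpha+\beta+n+l+1)}{(\alpha+\beta+2l)(\alpha+\beta+2n)}\mathsf{a}_{l+m-n,n,m}-\frac{(\alpha+\beta+2l+2)(\alpha+\beta+n+1)(n+1)}{\alpha+\beta+2n+1}\mathsf{a}_{l+m-n-1,n+1,m}$$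 $$-\frac{(\alpha+n)(\beta+n)(\alpha+\beta+2l+2)(\alpha+\beta+2n+2)}{(\alpha+\beta+2n+1)(\alpha+\beta+2n)}\mathsf{a}_{l+m-n+1,n-1,m}+\frac{(\alpha+\beta+2n+2)(\alpha+l+1)(\beta+l+1)}{\alpha+\beta+2l+3}\mathsf{a}_{l+m-n+1,n,m}$$ $$+\frac{l(\alpha+\beta+l)(\alpha+\beta+2l+2)(\alpha+\beta+2n+2)}{(\alpha+\beta+2l-1)(\alpha+\beta+2l)}\mathsf{a}_{l+m-n-1,n,m}=0;$$ $$\frac{2(\alpha-\beta)(\alpha+\beta)(l-m)(\alpha+\beta+m+l+1)}{(\alpha+\beta+2l)(\alpha+\beta+2l+2)(\alpha+\beta+2m)}\mathsf{a}_{l+m-n,n,m}-\frac{(m+1)(\alpha+\beta+m+1)}{\alpha+\beta+2m+1}\mathsf{a}_{l+m-n+1,n,m+1}$$ $$-\frac{(\alpha+m)(\beta+m)(\alpha+\beta+2m+2)}{(\alpha+\beta+2m)(\alpha+\beta+2m+1)}\mathsf{a}_{l+m-n-1,n,m-1}+\frac{(\alpha+l+1)(\beta+l+1)(\alpha+\beta+2m+2)}{(\alpha+\beta+2l+2)(\alpha+\beta+2l+3)}\mathsf{a}_{l+m-n+1,n,m}$$ $$+\frac{l(\alpha+\beta+l)(\alpha+\beta+2m+2)}{(\alpha+\beta+2l-1)(\alpha+\beta+2l)}\mathsf{a}_{l+m-n-1,n,m}=0.$$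
   Context: $\mathbb{N}_0=\{0,1,2,\ldots\}$; $(z)_j=z(z+1)\cdots(z+j-1)$, $(z_1,\ldots,z_r)_j=(z_1)_j\cdots(z_r)_j$; ${}_rF_s\!\left({a_1,\ldots,a_r\atop b_1,\ldots,b_s};x\right)=\sum_{j\ge0}\frac{(a_1,\ldots,a_r)_j}{(b_1,\ldots,b_s)_j}\frac{x^j}{j!}$. The Jacobi polynomials are $P_n^{(\alpha,\beta)}(x)=\frac{(\alpha+1)_n}{n!}{}_2F_1\!\left({-n,\,n+\alpha+\beta+1\atop\alpha+1};\frac{1-x}2\right)$. The coefficients $\mathsf{a}_{k,n,m}^{\alpha,\beta}$ are Rahman's linearization coefficients, i.e. for $n\ge m$, $P_m^{(\alpha,\beta)}(x)P_n^{(\alpha,\beta)}(x)=\sum_{k=0}^{2m}\mathsf{a}_{k,n,m}^{\alpha,\beta}P_{k+n-m}^{(\alpha,\beta)}(x)$. Explicitly, for $n\ge m$ and $0\le k\le2m$, $$\mathsf{a}_{k,n,m}^{\alpha,\beta}=\frac{(\alpha+1,\beta+1)_n(\alpha+\beta+1)_{2n-2m}(\alpha+\beta+1)_{2m}(\alpha+\beta+1+2n-2m+2k)}{m!\,(\alpha+\beta+1)_m(\alpha+1,\beta+1)_{n-m}(\alpha+\beta+2)_{2n}(\alpha+\beta+1)}$$ $$\times\frac{(n-m+1,\ \alpha+\beta+2n-2m+1,\ 2\alpha+2\beta+2n+2,\ -2m,\ \alpha-\beta)_k}{k!\,(2\beta+2n-2m+2,\ \alpha+n-m+1,\ \alpha+\beta+2n+2,\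 -\alpha-\beta-2m)_k}\;{}_9F_8\!\left({\mathbf a\atop\mathbf b};1\right),$$ $\mathbf a=\big(\beta+n-m+\frac12,\ \frac{\beta+n-m+\frac52}2,\ \beta+\frac12,\ \beta+n+1,\ -\alpha-m,\ \frac{\alpha+\beta+k+1}2+n-m,\ \frac{\alpha+\beta+k+2}2+n-m,\ \frac{-k}2,\ \frac{-k+1}2\big)$, $\mathbf b=\big(\frac{\beta+n-m+\frac12}2,\ n-m+1,\ \frac12-m,\ \alpha+\beta+n+\frac32,\ \frac{\beta-\alpha-k+1}2,\ \frac{\beta-\alpha-k+2}2,\ \frac{k+2}2+\beta+n-m,\ \frac{k+3}2+\beta+n-m\big)$, with values at removable singularities in $(\alpha,\beta)$ taken by continuity. Conventions: $\mathsf{a}_{k,n,m}=0$ when $n\ge m$ and $k\notin\{0,\ldots,2m\}$, and when $m=-1$ or $n=-1$; if $n<m$, $\mathsf{a}_{k,n,m}$ is the coefficient of $P^{(\alpha,\beta)}_{k+n-m}$ in $P_m^{(\alpha,\beta)}P_n^{(\alpha,\beta)}$, i.e. $\mathsf{a}_{k,n,m}=\mathsf{a}_{k+2(n-m),m,n}$. *)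

(* Defs.v *)
From mathcomp Require Import all_boot all_order all_algebra.
Set Implicit Arguments.
Unset Strict Implicit.
Unset Printing Implicit Defensive.
Import Order.TTheory GRing.Theory Num.Theory.
Local Open Scope ring_scope.

Definition poch (F : fieldType) (z : F) (j : nat) : F :=
  \prod_(i < j) (z + i%:R).

(* The 2F1 series terminates: (-n)_j = 0 for j > n. *)
Definition jacobi (F : fieldType) (alpha beta : F) (n : nat) : {poly F} :=
  (poch (alpha + 1) n / n`!%:R) *:
  \sum_(j < n.+1)
    (poch (- n%:R) j * poch (n%:R + alpha + beta + 1) j
       / (poch (alpha + 1) j * j`!%:R))
      *: ((2%:R^-1)%:P * (1 - 'X)) ^+ j.

(* For alpha, beta > -1 the polynomial jacobi alpha beta i has degree exactly i,
   so that the tuple below is a basis of the space of polynomials of degree at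
   most N. *)
Definition jacobi_basis (F : fieldType) (alpha beta : F) (N : nat) :
    N.+1.-tuple {poly_N.+1 F} :=
  [tuple npolyp N.+1 (jacobi alpha beta i) | i < N.+1].

(* The coefficient of P_l in P_m P_n, to be used only for l <= m + n. *)
Definition jacobi_prod_coef (F : fieldType) (alpha beta : F) (l n m : nat) : F :=
  coord (jacobi_basis alpha beta (m + n)) (inord l)
    (npolyp (m + n).+1 (jacobi alpha beta m * jacobi alpha beta n)).

(* a_{k,n,m} for m <= n. *)
Definition lin_coef_le (F : fieldType) (alpha beta : F) (k : int) (n m : nat) : F :=
  if (0 <= k <= (2 * m)%:Z)
  then jacobi_prod_coef alpha beta (absz (k + n%:Z - m%:Z)%R) n m
  else 0.

(* a_{k,n,m} for integer indices: it is zero if n or m is negative, and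
   a_{k,n,m} = a_{k+2(n-m),m,n} if n < m. *)
Definition lin_coef (F : fieldType) (alpha beta : F) (k n m : int) : F :=
  match n, m with
  | Posz n, Posz m =>
      if (m <= n)%N then lin_coef_le alpha beta k n m
      else lin_coef_le alpha beta (k + 2%:Z * (n%:Z - m%:Z)) m n
  | _, _ => 0
  end.

(* Main.v *)
Require Import Defs.
From mathcomp Require Import all_boot all_order all_algebra.
From mathcomp Require Import zify ring lra.
Import Order.TTheory GRing.Theory Num.Theory.
Local Open Scope ring_scope.

(* Multiplication by X acts on the Jacobi polynomials by a three-term
   recurrence.  Expanding X P_m P_n in the basis (P_l) by applying it to P_m, to
   P_n, or to every term of the expansion of P_m P_n gives three expressions for
   the coefficient of P_l; the three relations are their pairwise equalities,
   cleared of denominators.  The recurrence also shows by induction on m that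
   P_m P_n has no component on P_l for l < n - m, which is the convention that
   lin_coef builds in. *)

(** * Pochhammer symbols and the Jacobi coefficients in powers of (1 - X)/2 *)

Lemma poch0 {F : fieldType} (z : F) : poch z 0 = 1.
Proof. by rewrite /poch big_ord0. Qed.

Lemma pochSr {F : fieldType} (z : F) (j : nat) :
  poch z j.+1 = poch z j * (z + j%:R).
Proof. by rewrite /poch big_ord_recr. Qed.

Lemma pochSl {F : fieldType} (z : F) (j : nat) :
  poch z j.+1 = z * poch (z + 1) j.
Proof.
rewrite /poch big_ord_recl addr0; congr (_ * _); apply: eq_bigr => i _.
by rewrite /= /bump add1n -natr1 addrAC addrA.
Qed.

Lemma poch_oppn {F : fieldType} (n j : nat) :
  (n < j)%N -> poch (- n%:R : F) j = 0.
Proof. by move=> lt_nj; rewrite /poch (bigD1 (Ordinal lt_nj)) //= addNr mul0r. Qed.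

Lemma poch_gt0 (R : realFieldType) (z : R) (j : nat) : 0 < z -> 0 < poch z j.
Proof. by move=> z0; apply: prodr_gt0 => i _; rewrite ltr_wpDr. Qed.

(** This is the coefficient of ((1 - X)/2)^j in P_n. *)
Definition jcoef {F : fieldType} (alpha beta : F) (n j : nat) : F :=
  poch (alpha + 1) n / n`!%:R *
    (poch (- n%:R) j * poch (n%:R + alpha + beta + 1) j
       / (poch (alpha + 1) j * j`!%:R)).

Lemma jcoef_eq0 {F : fieldType} (alpha beta : F) (n j : nat) :
  (n < j)%N -> jcoef alpha beta n j = 0.
Proof. by move=> lt_nj; rewrite /jcoef poch_oppn // !mul0r mulr0. Qed.

(** The free bound [N] lets P_(n-1), P_n and P_(n+1) be written as sums over one common range. *)
Lemma jacobiE {F : fieldType} (alpha beta : F) {n N : nat} : (n < N)%N ->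
  jacobi alpha beta n =
  \sum_(j < N) jcoef alpha beta n j *: ((2%:R^-1)%:P * (1 - 'X)) ^+ j.
Proof.
move=> lt_nN; rewrite /jacobi scaler_sumr.
under eq_bigr => j _ do rewrite scalerA -[_ / _ * _]/(jcoef alpha beta n j).
rewrite (big_ord_widen N (fun j => jcoef alpha beta n j *: _ ^+ j) lt_nN).
rewrite big_mkcond; apply: eq_bigr => j _; rewrite ltnS.
by case: leqP => // /jcoef_eq0 ->; rewrite scale0r.
Qed.

Lemma jacobi0 {F : fieldType} (alpha beta : F) : jacobi alpha beta 0 = 1.
Proof.
rewrite (jacobiE alpha beta (ltnSn 0)) big_ord1 expr0 /jcoef !poch0 fact0.
by rewrite mulr1n !(mul1r, mulr1, invr1) -[RHS]scale1r.
Qed.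

(* The case n = 0 is split off because the general formulas degenerate to 0 / 0
   there: the first one when alpha + beta = -1, the other two when
   alpha + beta = 0. *)
Definition rec_up {F : fieldType} (alpha beta : F) (n : nat) : F :=
  if n is 0 then 2 / (alpha + beta + 2) else
  2 * (n%:R + 1) * (n%:R + alpha + beta + 1)
    / ((alpha + beta + 2 * n%:R + 1) * (alpha + beta + 2 * n%:R + 2)).

Definition rec_mid {F : fieldType} (alpha beta : F) (n : nat) : F :=
  if n is 0 then (beta - alpha) / (alpha + beta + 2) else
  (beta - alpha) * (alpha + beta)
    / ((alpha + beta + 2 * n%:R) * (alpha + beta + 2 * n%:R + 2)).

Definition rec_down {F : fieldType} (alpha beta : F) (n : nat) : F :=
  if n is 0 then 0 else
  2 * (n%:R + alpha) * (n%:R + beta)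
    / ((alpha + beta + 2 * n%:R) * (alpha + beta + 2 * n%:R + 1)).

Section Jacobi.
Context {R : realFieldType} (alpha beta : R).
Hypotheses (halpha : -1 < alpha) (hbeta : -1 < beta).

(** * The three-term recurrence *)

Let poch_neq0 (j : nat) : poch (alpha + 1) j != 0.
Proof. by apply/lt0r_neq0/poch_gt0; move: halpha; lra. Qed.

Let fact_neq0 (j : nat) : j`!%:R != 0 :> R.
Proof. by rewrite pnatr_eq0 -lt0n fact_gt0. Qed.

(** With y = (1 - X)/2 one has X = 1 - 2y, so this is the coefficient of y^j in the three-term
    recurrence for X P_n. For n = 0 the last term vanishes through [rec_down], whatever [n.-1] means
    there. *)
Lemma jcoef_rec (n j : nat) :
  jcoef alpha beta n j - 2 * (if j is i.+1 then jcoef alpha beta n i else 0) =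
  rec_up alpha beta n * jcoef alpha beta n.+1 j
  + rec_mid alpha beta n * jcoef alpha beta n j
  + rec_down alpha beta n * jcoef alpha beta n.-1 j.
Proof.
move: (halpha) (hbeta) => ha hb; case: n => [|n].
  case: j => [|[|j]]; last first.
  - by rewrite !jcoef_eq0 // ?mulr0 ?subr0 ?addr0; case: j.
  - rewrite /= /jcoef !(pochSr, poch0) !factS fact0; field.
    by do ?[apply/andP; split]; apply: lt0r_neq0; lra.
  - rewrite /= /jcoef !(pochSr, poch0) !factS fact0; field.
    by do ?[apply/andP; split]; apply: lt0r_neq0; lra.
have n0 : 0 <= n%:R :> R by [].
have f0 := fact_neq0 n.
have a0 := poch_neq0 n.
have E2 : - n.+1%:R = - n%:R - 1 :> R by rewrite -!natr1; ring.
have E1 : - n.+2%:R = - n%:R - 2 :> R by rewrite -!natr1; ring.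
have E4 : n.+1%:R = n%:R + 1 :> R by rewrite -!natr1; ring.
have E3 : n.+2%:R = n%:R + 2 :> R by rewrite -!natr1; ring.
(* The factorisations for general j strip two factors off a Pochhammer symbol, so j = 0 and j = 1
   are computed directly. *)
case: j => [|[|j]].
- rewrite /= /jcoef !(pochSr, poch0) !factS fact0 !natrM ?E2 ?E1 E4 E3.
  field.
  by rewrite ?f0; do ?[apply/andP; split] => //; apply: lt0r_neq0; lra.
- rewrite /= /jcoef !(pochSr, poch0) !factS fact0 !natrM ?E2 ?E1 E4 E3.
  field.
  by rewrite ?f0; do ?[apply/andP; split] => //; apply: lt0r_neq0; lra.
have j0 : 0 <= j%:R :> R by [].
have F4 : j.+1%:R = j%:R + 1 :> R by rewrite -!natr1; ring.
have F3 : j.+2%:R = j%:R + 2 :> R by rewrite -!natr1; ring.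
have g0 := fact_neq0 j.
have b0 := poch_neq0 j.
rewrite /= /jcoef.
(* Every Pochhammer symbol in the identity is a rational multiple of u or v, so
   that it becomes an identity between rational functions. *)
pose u : R := poch (- n%:R) j.
pose v := poch (n%:R + alpha + beta + 3) j.
have U1 : poch (- n.+1%:R) j.+1 = (- n%:R - 1) * u.
  by rewrite pochSl E2; congr (_ * poch _ _); ring.
have U2 : poch (- n.+1%:R) j.+2 = (- n%:R - 1) * u * (j%:R - n%:R).
  by rewrite pochSr U1 E2 F4; ring.
have U3 : poch (- n.+2%:R) j.+2 = (- n%:R - 2) * (- n%:R - 1) * u.
  by rewrite pochSl -mulrA -U1 E1 E2; congr (_ * poch _ _); ring.
have U4 : poch (- n%:R) j.+2 = u * (j%:R - n%:R) * (j%:R - n%:R + 1).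
  by rewrite !pochSr F4 -/u; ring.
have V1 : poch (n.+1%:R + alpha + beta + 1) j.+1
    = (n%:R + alpha + beta + 2) * v.
  by rewrite pochSl E4; congr (_ * poch _ _); ring.
have V2 : poch (n.+1%:R + alpha + beta + 1) j.+2
    = (n%:R + alpha + beta + 2) * v * (n%:R + alpha + beta + 3 + j%:R).
  by rewrite pochSr V1 E4 F4; ring.
have V3 : poch (n.+2%:R + alpha + beta + 1) j.+2
    = v * (n%:R + alpha + beta + 3 + j%:R) * (n%:R + alpha + beta + 4 + j%:R).
  rewrite !pochSr F4 E3 (_ : n%:R + 2 + _ + _ + _ = n%:R + alpha + beta + 3).
    by rewrite -/v; ring.
  by ring.
have V4 : poch (n%:R + alpha + beta + 1) j.+2
    = (n%:R + alpha + beta + 1) * ((n%:R + alpha + beta + 2) * v).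
  by rewrite -V1 pochSl E4; congr (_ * poch _ _); ring.
rewrite U1 U2 U3 U4 V1 V2 V3 V4.
rewrite !(pochSr (_ + 1)) !factS !natrM E4 E3 F4 F3.
field.
by rewrite ?f0 ?a0 ?b0 ?g0; do ?[apply/andP; split] => //; apply: lt0r_neq0; lra.
Qed.

Lemma jacobi_rec (n : nat) :
  'X * jacobi alpha beta n =
  rec_up alpha beta n *: jacobi alpha beta n.+1
  + rec_mid alpha beta n *: jacobi alpha beta n
  + rec_down alpha beta n *: jacobi alpha beta n.-1.
Proof.
pose y : {poly R} := (2%:R^-1)%:P * (1 - 'X).
have Xy : 'X = 1 - 2 *: y.
  by rewrite /y -mul_polyC mulrA -polyCM divff ?pnatr_eq0 // mul1r subKr.
have ltn2 : (n.-1 < n.+2)%N by case: (n) => // k; rewrite /= ltnW.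
rewrite (jacobiE alpha beta (N := n.+2) ltn2).
rewrite (jacobiE alpha beta (N := n.+2) (ltnSn n.+1)).
rewrite [X in _ = _ + _ *: X + _](jacobiE alpha beta (N := n.+2)) // -/y.
rewrite !scaler_sumr -!big_split /= Xy mulrBl mul1r.
rewrite {1}(jacobiE alpha beta (N := n.+2)) // (jacobiE alpha beta (ltnSn n)).
rewrite -/y -scalerAl mulr_sumr scaler_sumr.
have -> : \sum_(j < n.+1) 2 *: (y * (jcoef alpha beta n j *: y ^+ j)) =
    \sum_(j < n.+2)
      (2 * (if val j is i.+1 then jcoef alpha beta n i else 0)) *: y ^+ j.
  rewrite [RHS]big_ord_recl /= mulr0 scale0r add0r; apply: eq_bigr => j _.
  by rewrite /bump add1n -scalerAr -exprS scalerA.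
rewrite -sumrB; apply: eq_bigr => j _.
by rewrite -scalerBl jcoef_rec !scalerDl !scalerA.
Qed.

(** * Degrees, linear independence and the basis property *)

Lemma rec_up_neq0 (n : nat) : rec_up alpha beta n != 0.
Proof.
move: (halpha) (hbeta) => ha hb; case: n => [|n] /=.
  by apply: lt0r_neq0; apply: divr_gt0; lra.
have n0 : 0 <= n%:R :> R by [].
rewrite -natr1; apply: lt0r_neq0.
by apply: divr_gt0; apply: mulr_gt0; try apply: mulr_gt0; lra.
Qed.

(** In the recurrence X P_n has degree n + 1, while the terms in P_n and P_(n-1) have degree at most
    n; since [rec_up] is nonzero, P_(n+1) carries the leading term. *)
Lemma size_jacobi (n : nat) : size (jacobi alpha beta n) = n.+1.
Proof.
suff: size (jacobi alpha beta n) = n.+1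
    /\ (size (jacobi alpha beta n.-1) <= n.+1)%N by case.
elim: n => [|n [IHn IHn1]].
  by rewrite jacobi0 size_poly1.
split; last by rewrite /= IHn.
have : size ('X * jacobi alpha beta n) = n.+2.
  by rewrite mulrC size_mulX ?IHn // -size_poly_gt0 IHn.
rewrite jacobi_rec -addrA => szX.
rewrite -(size_scale _ (rec_up_neq0 n)).
set p := _ *: jacobi _ _ n.+1 in szX *.
set q := rec_mid _ _ _ *: _ + _ in szX.
have szq : (size q <= n.+1)%N.
  rewrite /q; apply: (leq_trans (size_polyD _ _)); rewrite geq_max; apply/andP.
  by split; apply: (leq_trans (size_scale_leq _ _)); rewrite ?IHn.
by rewrite -szX -[in LHS](addrK q p) size_polyDl // size_polyN szX ltnS.
Qed.

(** The degrees are distinct, so a nonzero top coefficient cannot be cancelled by the lower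
    terms. *)
Lemma jacobi_sum_eq0 {N : nat} {d : nat -> R} :
  \sum_(i < N) d i *: jacobi alpha beta i = 0 -> forall i, (i < N)%N -> d i = 0.
Proof.
elim: N => [|N IHN] //; rewrite big_ord_recr /= => sum0.
have dN0 : d N = 0.
  apply/eqP/negPn/negP => dN.
  have szS : (size (\sum_(i < N) d i *: jacobi alpha beta i)%R < N.+1)%N.
    rewrite ltnS; apply: (leq_trans (size_sum _ _ _)).
    apply/bigmax_leqP => i _; apply: (leq_trans (size_scale_leq _ _)).
    by rewrite size_jacobi.
  have := congr1 (fun p : {poly R} => size p) sum0.
  by rewrite addrC size_polyDl size_scale // size_jacobi // size_poly0.
move: sum0; rewrite dN0 scale0r addr0 => /IHN d0 i.
by rewrite ltnS leq_eqVlt => /orP[/eqP->|/d0].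
Qed.

Lemma jacobi_sum_inj {N : nat} {d e : nat -> R} :
  \sum_(i < N) d i *: jacobi alpha beta i
  = \sum_(i < N) e i *: jacobi alpha beta i ->
  forall i, (i < N)%N -> d i = e i.
Proof.
move=> /eqP; rewrite -subr_eq0 -sumrB => /eqP de i ltiN; apply/eqP.
rewrite -subr_eq0; apply/eqP.
apply: (jacobi_sum_eq0 (N := N) (d := fun i => d i - e i)) => //.
by rewrite -[RHS]de; apply: eq_bigr => j _; rewrite scalerBl.
Qed.

Lemma jacobi_basisE (N : nat) (i : 'I_N.+1) :
  ((jacobi_basis alpha beta N)`_i : {poly R}) = jacobi alpha beta i.
Proof.
rewrite -tnth_nth tnth_mktuple npolypK // size_jacobi; exact: ltn_ord.
Qed.

Lemma jacobi_basis_full (N : nat) :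
  basis_of fullv (jacobi_basis alpha beta N).
Proof.
rewrite basisEfree subvf size_tuple dim_polyn leqnn !andbT /=.
apply/(@freeP _ _ N.+1 (jacobi_basis alpha beta N)) => k sum0 i.
have := jacobi_sum_eq0 (N := N.+1) (d := fun j => k (inord j)).
move/(_ _ i (ltn_ord i)); rewrite inord_val; apply.
move/(congr1 (@polyn R N.+1)): sum0; rewrite raddf_sum /= => sum0.
apply: etrans sum0; apply: eq_bigr => j _.
by rewrite inord_val -[in LHS]jacobi_basisE.
Qed.

(** * Expansion of products, and multiplication by X on expansions *)

(** The cutoff is needed because [inord l] falls back to index 0 once l > m + n, which would return
    the coefficient of P_0. *)
Definition prod_coef (m n l : nat) : R :=
  if (l <= m + n)%N then jacobi_prod_coef alpha beta l n m else 0.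

Lemma jacobi_prodE {m n N : nat} : (m + n < N)%N ->
  jacobi alpha beta m * jacobi alpha beta n =
  \sum_(i < N) prod_coef m n i *: jacobi alpha beta i.
Proof.
move=> lt_N.
have szP : (size (jacobi alpha beta m * jacobi alpha beta n)%R <= (m + n).+1)%N.
  by apply: (leq_trans (size_polyMleq _ _)); rewrite !size_jacobi; lia.
rewrite -[LHS](npolypK szP).
have /(congr1 (@polyn R _)) := coord_basis (jacobi_basis_full (m + n))
  (memvf (npolyp (m + n).+1 (jacobi alpha beta m * jacobi alpha beta n))).
rewrite raddf_sum /= => ->.
transitivity (\sum_(i < (m + n).+1) prod_coef m n i *: jacobi alpha beta i).
  apply: eq_bigr => i _; rewrite jacobi_basisE /prod_coef -ltnS ltn_ord.
  by rewrite /jacobi_prod_coef inord_val.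
rewrite (big_ord_widen N (fun i => prod_coef m n i *: jacobi alpha beta i)) //.
rewrite big_mkcond; apply: eq_bigr => i _; rewrite ltnS.
by case: ifP => // lei; rewrite /prod_coef lei scale0r.
Qed.

Lemma prod_coefC (m n l : nat) : prod_coef m n l = prod_coef n m l.
Proof.
apply: (jacobi_sum_inj (N := (m + n + l).+1)); last by lia.
by rewrite -!jacobi_prodE; [rewrite mulrC | lia | lia].
Qed.

(** The transpose of the tridiagonal matrix of the recurrence: it sends the coefficients of a
    polynomial in the basis (P_i) to those of X times it. *)
Definition rec_shift (d : nat -> R) (i : nat) : R :=
  (if i is j.+1 then rec_up alpha beta j * d j else 0)
  + rec_mid alpha beta i * d i + rec_down alpha beta i.+1 * d i.+1.

Lemma mulX_jacobi_sum (N : nat) (d : nat -> R) :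
  (forall i, (N <= i)%N -> d i = 0) ->
  'X * \sum_(i < N) d i *: jacobi alpha beta i =
  \sum_(i < N.+1) rec_shift d i *: jacobi alpha beta i.
Proof.
move=> d0; rewrite mulr_sumr.
under eq_bigr => i _ do rewrite -scalerAr jacobi_rec !scalerDr !(scalerA (d i)).
under [RHS]eq_bigr => i _ do rewrite !scalerDl.
rewrite !big_split /=; congr (_ + _ + _).
- rewrite [RHS]big_ord_recl /= scale0r add0r; apply: eq_bigr => i _.
  by rewrite /bump add1n add0n mulrC.
- rewrite [RHS]big_ord_recr /= d0 // mulr0 scale0r addr0.
  by apply: eq_bigr => i _; rewrite mulrC.
(* Two zero terms are appended, as [d] vanishes from [N] on. The term i = 0 then drops out because
   [rec_down] is 0 there, and reindexing leaves N + 1 terms. *)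
- transitivity (\sum_(i < N.+2) (d i * rec_down alpha beta i)
      *: jacobi alpha beta i.-1).
    by rewrite !big_ord_recr /= !d0 // !mul0r !scale0r !addr0.
  rewrite big_ord_recl /= mulr0 scale0r add0r.
  by apply: eq_bigr => i _; rewrite mulrC.
Qed.

(** Both sides are the coefficient of P_l in X P_m P_n: on the left X acts on P_m, on the right on
    the expansion of the product. *)
Lemma prod_coef_rec (m n l : nat) :
  rec_up alpha beta m * prod_coef m.+1 n l
  + rec_mid alpha beta m * prod_coef m n l
  + rec_down alpha beta m * prod_coef m.-1 n l
  = rec_shift (prod_coef m n) l.
Proof.
pose N := (m + n + l).+1.
have d0 i : (N <= i)%N -> prod_coef m n i = 0.
  by move=> leNi; rewrite /prod_coef ifF //; apply/negP; rewrite /N in leNi; lia.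
apply: (jacobi_sum_inj (N := N.+1)
  (d := fun l => rec_up alpha beta m * prod_coef m.+1 n l
    + rec_mid alpha beta m * prod_coef m n l
    + rec_down alpha beta m * prod_coef m.-1 n l)); last by rewrite /N; lia.
rewrite -mulX_jacobi_sum // -jacobi_prodE /N; last by lia.
rewrite mulrA jacobi_rec !mulrDl -!(scalerAl (_ _ _ m)).
rewrite !(jacobi_prodE (N := N.+1)) /N; try lia.
rewrite !scaler_sumr -!big_split /=; apply: eq_bigr => i _.
by rewrite !scalerDl !(scalerA (_ _ _ m)).
Qed.

(* This is the orthogonality of [P_m P_l] and [P_n], obtained without integrals:
   multiplication by X moves the support of an expansion by at most one. *)
Lemma prod_coef_eq0 (m n l : nat) : (l + m < n)%N -> prod_coef m n l = 0.
Proof.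
(* The recurrence in m has two steps, so the induction carries the statement for m - 1 as well. *)
suff: ((l + m < n)%N -> prod_coef m n l = 0) /\
      ((l + m.-1 < n)%N -> prod_coef m.-1 n l = 0) by case.
elim: m l => [|m IHm] l.
  suff Z : (l < n)%N -> prod_coef 0 n l = 0 by rewrite /= addn0.
  move=> ltln.
  (* Since P_0 = 1, the expansion of P_0 P_n is the Kronecker delta at n. *)
  rewrite (jacobi_sum_inj (N := n.+1) (d := prod_coef 0 n)
    (e := fun i => (i == n)%:R)); [by rewrite ltn_eqF | | by rewrite ltnW].
  rewrite -jacobi_prodE // jacobi0 mul1r big_ord_recr /= eqxx scale1r big1 ?add0r //.
  by move=> i _; rewrite ltn_eqF // scale0r.
split => [ltl|]; last by case: (IHm l).
(* The recurrence expresses the coefficient for m + 1 through those of P_m P_n at l - 1, l, l + 1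
   and of P_(m-1) P_n at l; all vanish because l + 1 + m < n. *)
apply: (mulfI (rec_up_neq0 m)); rewrite mulr0.
have := prod_coef_rec m n l; rewrite /rec_shift.
rewrite (proj1 (IHm l)); last by lia.
rewrite (proj1 (IHm l.+1)); last by lia.
rewrite (proj2 (IHm l)); last by lia.
rewrite !mulr0 !addr0 => ->; case: l ltl => [|l] ltl //.
by rewrite (proj1 (IHm l)) ?mulr0 //; lia.
Qed.

(** For m <= n, the range 0 <= k <= 2m amounts to n - m <= l <= n + m. Above it [prod_coef] is 0 by
    definition, below it by [prod_coef_eq0]; the case n < m follows by symmetry. *)
Lemma lin_coefE (k : int) (n m l : nat) : k + n%:Z - m%:Z = l%:Z ->
  lin_coef alpha beta k n m = prod_coef m n l.
Proof.
have le_case (j : int) (p q : nat) : (q <= p)%N -> j + p%:Z - q%:Z = l%:Z ->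
    lin_coef_le alpha beta j p q = prod_coef q p l.
  move=> leqp jE; rewrite /lin_coef_le jE /prod_coef absz_nat.
  case: ifP => [jr|jr].
    by rewrite ifT //; lia.
  case: ifP => // le_l.
  by have := @prod_coef_eq0 q p l; rewrite /prod_coef le_l => -> //; lia.
rewrite /lin_coef; case: ifP => lemn kE; first exact: le_case.
by rewrite prod_coefC; apply: le_case; lia.
Qed.

(** Away from the 0 / 0 case the generic formula also holds at n = 0, after cancelling alpha + beta
    + 1. *)
Lemma rec_upE (n : nat) : alpha + beta + 2 * n%:R + 1 != 0 ->
  rec_up alpha beta n =
  2 * (n%:R + 1) * (n%:R + alpha + beta + 1)
    / ((alpha + beta + 2 * n%:R + 1) * (alpha + beta + 2 * n%:R + 2)).
Proof.
move: (halpha) (hbeta) => ha hb; case: n => [|n] //=.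
rewrite mulr0 addr0 => h; field.
by rewrite h ?andbT /=; apply: lt0r_neq0; lra.
Qed.

Lemma rec_midE (n : nat) : alpha + beta + 2 * n%:R != 0 ->
  rec_mid alpha beta n =
  (beta - alpha) * (alpha + beta)
    / ((alpha + beta + 2 * n%:R) * (alpha + beta + 2 * n%:R + 2)).
Proof.
move: (halpha) (hbeta) => ha hb; case: n => [|n] //=.
rewrite mulr0 addr0 => h; field.
by rewrite h ?andbT /=; apply: lt0r_neq0; lra.
Qed.

End Jacobi.

Theorem theorem6p3 (R : realFieldType) (alpha beta : R)
    (halpha : -1 < alpha) (hbeta : -1 < beta) (l m n : nat)
    (hmn : (m <= n)%N) (hl : (n - m <= l <= n + m)%N) :
  let a (k n m : int) : R := lin_coef alpha beta k n m in
  let K : int := l%:Z + m%:Z - n%:Z in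
  [/\ (alpha + beta + 2 * m%:R != 0 -> alpha + beta + 2 * n%:R != 0 ->
       alpha + beta + 2 * m%:R + 1 != 0 ->
         2 * (alpha - beta) * (alpha + beta) * (m%:R - n%:R)
           * (alpha + beta + m%:R + n%:R + 1) * (alpha + beta + 2 * n%:R + 1)
           / ((alpha + beta + 2 * m%:R) * (alpha + beta + 2 * n%:R))
           * a K n%:Z m%:Z
       + (alpha + beta + m%:R + 1) * (m%:R + 1)
           * (alpha + beta + 2 * n%:R + 1) * (alpha + beta + 2 * n%:R + 2)
           / (alpha + beta + 2 * m%:R + 1)
           * a (K + 1) n%:Z (m%:Z + 1)
       + (alpha + m%:R) * (beta + m%:R) * (alpha + beta + 2 * m%:R + 2)
           * (alpha + beta + 2 * n%:R + 1) * (alpha + beta + 2 * n%:R + 2)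
           / ((alpha + beta + 2 * m%:R) * (alpha + beta + 2 * m%:R + 1))
           * a (K - 1) n%:Z (m%:Z - 1)
       - (alpha + beta + 2 * m%:R + 2) * (alpha + beta + n%:R + 1) * (n%:R + 1)
           * a (K - 1) (n%:Z + 1) m%:Z
       - (alpha + beta + 2 * m%:R + 2) * (alpha + n%:R) * (beta + n%:R)
           * (alpha + beta + 2 * n%:R + 2)
           / (alpha + beta + 2 * n%:R)
           * a (K + 1) (n%:Z - 1) m%:Z
       = 0),
      (alpha + beta + 2 * l%:R != 0 -> alpha + beta + 2 * n%:R != 0 ->
       alpha + beta + 2 * n%:R + 1 != 0 -> alpha + beta + 2 * l%:R + 3 != 0 ->
       alpha + beta + 2 * l%:R - 1 != 0 ->
         2 * (alpha - beta) * (alpha + beta) * (l%:R - n%:R)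
           * (alpha + beta + n%:R + l%:R + 1)
           / ((alpha + beta + 2 * l%:R) * (alpha + beta + 2 * n%:R))
           * a K n%:Z m%:Z
       - (alpha + beta + 2 * l%:R + 2) * (alpha + beta + n%:R + 1) * (n%:R + 1)
           / (alpha + beta + 2 * n%:R + 1)
           * a (K - 1) (n%:Z + 1) m%:Z
       - (alpha + n%:R) * (beta + n%:R) * (alpha + beta + 2 * l%:R + 2)
           * (alpha + beta + 2 * n%:R + 2)
           / ((alpha + beta + 2 * n%:R + 1) * (alpha + beta + 2 * n%:R))
           * a (K + 1) (n%:Z - 1) m%:Z
       + (alpha + beta + 2 * n%:R + 2) * (alpha + l%:R + 1) * (beta + l%:R + 1)
           / (alpha + beta + 2 * l%:R + 3)
           * a (K + 1) n%:Z m%:Z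
       + l%:R * (alpha + beta + l%:R) * (alpha + beta + 2 * l%:R + 2)
           * (alpha + beta + 2 * n%:R + 2)
           / ((alpha + beta + 2 * l%:R - 1) * (alpha + beta + 2 * l%:R))
           * a (K - 1) n%:Z m%:Z
       = 0)
    & (alpha + beta + 2 * l%:R != 0 -> alpha + beta + 2 * l%:R + 2 != 0 ->
       alpha + beta + 2 * m%:R != 0 -> alpha + beta + 2 * m%:R + 1 != 0 ->
       alpha + beta + 2 * l%:R + 3 != 0 -> alpha + beta + 2 * l%:R - 1 != 0 ->
         2 * (alpha - beta) * (alpha + beta) * (l%:R - m%:R)
           * (alpha + beta + m%:R + l%:R + 1)
           / ((alpha + beta + 2 * l%:R) * (alpha + beta + 2 * l%:R + 2)
              * (alpha + beta + 2 * m%:R))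
           * a K n%:Z m%:Z
       - (m%:R + 1) * (alpha + beta + m%:R + 1)
           / (alpha + beta + 2 * m%:R + 1)
           * a (K + 1) n%:Z (m%:Z + 1)
       - (alpha + m%:R) * (beta + m%:R) * (alpha + beta + 2 * m%:R + 2)
           / ((alpha + beta + 2 * m%:R) * (alpha + beta + 2 * m%:R + 1))
           * a (K - 1) n%:Z (m%:Z - 1)
       + (alpha + l%:R + 1) * (beta + l%:R + 1) * (alpha + beta + 2 * m%:R + 2)
           / ((alpha + beta + 2 * l%:R + 2) * (alpha + beta + 2 * l%:R + 3))
           * a (K + 1) n%:Z m%:Z
       + l%:R * (alpha + beta + l%:R) * (alpha + beta + 2 * m%:R + 2)
           / ((alpha + beta + 2 * l%:R - 1) * (alpha + beta + 2 * l%:R))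
           * a (K - 1) n%:Z m%:Z
       = 0)].
Proof.
move=> a K.
pose D := prod_coef alpha beta.
have aE (k : int) (p q i : nat) : k + p%:Z - q%:Z = i%:Z -> a k p%:Z q%:Z = D q p i.
  exact: lin_coefE.
have aDK : a K n%:Z m%:Z = D m n l by apply: aE; rewrite /K; lia.
have aDl : a (K + 1) n%:Z m%:Z = D m n l.+1 by apply: aE; rewrite /K; lia.
have aDm : a (K + 1) n%:Z (m%:Z + 1) = D m.+1 n l.
  by rewrite (_ : m%:Z + 1 = m.+1%:Z); [apply: aE; rewrite /K|]; lia.
have aDn : a (K - 1) (n%:Z + 1) m%:Z = D m n.+1 l.
  by rewrite (_ : n%:Z + 1 = n.+1%:Z); [apply: aE; rewrite /K|]; lia.
(* For m = 0 both sides are 0: on the left through [rec_down], on the right by the convention for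
   index -1. *)
have down_m : rec_down alpha beta m * D m.-1 n l =
    2 * (m%:R + alpha) * (m%:R + beta)
    / ((alpha + beta + 2 * m%:R) * (alpha + beta + 2 * m%:R + 1))
      * a (K - 1) n%:Z (m%:Z - 1).
  case: m @K hmn hl {aDK aDl aDm aDn} => [|p] K _ _.
    by rewrite mul0r /a /lin_coef /= mulr0.
  rewrite (_ : p.+1%:Z - 1 = p%:Z); last by lia.
  by congr (_ * _); rewrite (aE _ _ _ l) // /K; lia.
have down_n : rec_down alpha beta n * D m n.-1 l =
    2 * (n%:R + alpha) * (n%:R + beta)
    / ((alpha + beta + 2 * n%:R) * (alpha + beta + 2 * n%:R + 1))
      * a (K + 1) (n%:Z - 1) m%:Z.
  case: n @K hmn hl {aDK aDl aDm aDn down_m} => [|p] K _ _.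
    by rewrite mul0r /a /lin_coef /= mulr0.
  rewrite (_ : p.+1%:Z - 1 = p%:Z); last by lia.
  by congr (_ * _); rewrite (aE _ _ _ l) // /K; lia.
(* For l = 0 the factor l on the right accounts for the missing P_(-1); otherwise this is [rec_up]
   at l - 1. *)
have up_l : alpha + beta + 2 * l%:R - 1 != 0 ->
    (if l is j.+1 then rec_up alpha beta j * D m n j else 0) =
    2 * l%:R * (l%:R + alpha + beta)
    / ((alpha + beta + 2 * l%:R - 1) * (alpha + beta + 2 * l%:R))
      * a (K - 1) n%:Z m%:Z.
  case: l @K hl {aDK aDl aDm aDn down_m down_n} => [|p] K _.
    by rewrite !(mulr0, mul0r).
  have p0 : 0 <= p%:R :> R by [].
  have pS : p.+1%:R = p%:R + 1 :> R by rewrite natr1.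
  rewrite pS (aE _ _ _ p) => [h|]; last by rewrite /K; lia.
  have hp : alpha + beta + 2 * p%:R + 1 != 0.
    by move: h; rewrite (_ : _ - 1 = alpha + beta + 2 * p%:R + 1) //; ring.
  rewrite rec_upE //; congr (_ * _); field.
  by rewrite h andbT; apply: lt0r_neq0; lra.
have rec_m := prod_coef_rec _ _ halpha hbeta m n l.
(* X now acts on P_n; the symmetry of the product brings this to the same right-hand side as
   [rec_m]. *)
have rec_n := prod_coef_rec _ _ halpha hbeta n m l.
have shiftC : rec_shift alpha beta (prod_coef alpha beta n m) l
    = rec_shift alpha beta (prod_coef alpha beta m n) l.
  rewrite /rec_shift !(prod_coefC _ _ halpha hbeta n m).
  by case: (l) => // i; rewrite (prod_coefC _ _ halpha hbeta n m).
rewrite shiftC !(prod_coefC _ _ halpha hbeta _ m) in rec_n.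
rewrite /rec_shift -/D down_m -aDm -aDK -aDl in rec_m.
rewrite /rec_shift -/D down_n -aDn -aDK -aDl in rec_n.
have s2 (i : nat) : alpha + beta + 2 * i%:R + 2 != 0.
  by apply: lt0r_neq0; have : 0 <= i%:R :> R by []; lra.
have downS_l : rec_down alpha beta l.+1 =
    2 * (l%:R + 1 + alpha) * (l%:R + 1 + beta)
    / ((alpha + beta + 2 * l%:R + 2) * (alpha + beta + 2 * l%:R + 3)).
  by rewrite /= -natr1; congr (_ / (_ * _)); ring.
split.
- move=> hm hn hm1.
  (* If n = 0 then m = 0 and this is [hm1]; if n >= 1 the quantity is positive, as alpha + beta >
     -2. *)
  have hn1 : alpha + beta + 2 * n%:R + 1 != 0.
    case: (posnP n) hm1 => [n_eq0|n_gt0 _].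
      by move: hmn; rewrite n_eq0 leqn0 => /eqP ->.
    have : 1 <= n%:R :> R by rewrite ler1n.
    by move=> n1; apply: lt0r_neq0; lra.
  have /eqP := etrans rec_m (esym rec_n).
  rewrite !rec_upE // !rec_midE // -subr_eq0 => /eqP E.
  (* The factor is chosen to turn the difference of the two recurrences into the stated
     normalisation; the division by 2 removes the 2 in [rec_up] and [rec_down]. The other two
     relations are obtained likewise, with a minus sign since their terms come with opposite
     signs. *)
  apply: etrans (mulr0 ((alpha + beta + 2 * m%:R + 2)
    * (alpha + beta + 2 * n%:R + 1) * (alpha + beta + 2 * n%:R + 2) / 2)).
  rewrite -[in RHS]E; field.
  by rewrite hm hn hm1 hn1 !s2.
- move=> hl0 hn hn1 hl3 hl1; move/eqP: rec_n.
  rewrite up_l // downS_l rec_upE // !rec_midE // -subr_eq0 => /eqP E.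
  apply: etrans (mulr0 (- ((alpha + beta + 2 * l%:R + 2)
    * (alpha + beta + 2 * n%:R + 2) / 2))).
  rewrite -[in RHS]E; field.
  by rewrite hl0 hl1 hl3 hn hn1 !s2.
- move=> hl0 hl2 hm hm1 hl3 hl1; move/eqP: rec_m.
  rewrite up_l // downS_l rec_upE // !rec_midE // -subr_eq0 => /eqP E.
  apply: etrans (mulr0 (- ((alpha + beta + 2 * m%:R + 2) / 2))).
  rewrite -[in RHS]E; field.
  by rewrite hl0 hl1 hl2 hl3 hm hm1 !s2.
Qed.
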